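(* Let $V:S\to S$ be a Volterra operator. Then: (i) every face $F$ of $S$ is invariant with respect to $V$, i.e. $V(F)\subset F$; (ii) $\mathrm{Extr}(S)\subset \mathrm{Fix}(V)$, i.e. $V(e^{(n)})=e^{(n)}$ for every $n\in\mathbb N$.
   Context: $S=\{x=(x_n)_{n\in\mathbb N}\in\ell^1 : x_n\ge 0,\ \sum_{n=1}^\infty x_n=1\}$. Its set of extreme points is $\mathrm{Extr}(S)=\{e^{(n)}:n\in\mathbb N\}$, where $e^{(n)}$ has $n$-th coordinate $1$ and all others $0$. A convex set $C\subset S$ is a face of $S$ if $\lambda x+(1-\lambda)y\in C$ with $x,y\in S$, $\lambda\in(0,1)$ implies $x,y\in C$. A quadratic operator (q.o.) is a map $V:S\to S$, $V(x)=\tilde V(x,x)$, where $(\tilde V(x,y))_k=\sum_{i,j=1}^\infty p_{ij,k}x_iy_j$ for $x,y\in S$, $k\in\mathbb N$, and $(p_{ij,k})_{i,j,k\in\mathbb N}$ satisfies $p_{ij,k}\ge 0$, $p_{ij,k}=p_{ji,k}$, $\sum_{k=1}^\infty p_{ij,k}=1$. A q.o. $V$ is a Volterra operator if for all $\varphi,\psi\in\mathrm{Extr}(S)$ one has $\tilde V(\varphi,\psi)\in\{\lambda\varphi+(1-\lambda)\psi:\lambda\in[0,1]\}$. $\mathrm{Fix}(V)=\{x\in S: V(x)=x\}$. *)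

(* Defs.v *)
From mathcomp Require Import all_boot all_order all_algebra.
From mathcomp Require Import all_classical all_reals all_analysis.

Set Implicit Arguments.
Unset Strict Implicit.
Unset Printing Implicit Defensive.

Import Order.TTheory GRing.Theory Num.Theory.
Import numFieldNormedType.Exports.

Local Open Scope classical_set_scope.
Local Open Scope ring_scope.

(* Sequences are indexed from 0. *)
Definition simplex (R : realType) : set (nat -> R) :=
  [set x | [/\ summable [set: nat] (EFin \o x),
               (forall n, 0 <= x n) &
               series x @ \oo --> (1 : R)]].
Arguments simplex R : clear implicits.

Definition unit_seq (R : realType) (n : nat) : nat -> R :=
  fun m => (m == n)%:R.
Arguments unit_seq R n : clear implicits.

Definition extreme_points (R : realType) (E : lmodType R) (S : set E) : set E :=
  [set z | S z /\
    forall (x y : E) (l : R), S x -> S y -> 0 < l < 1 ->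
      l *: x + (1 - l) *: y = z -> x = z /\ y = z].

Definition is_face (R : realType) (E : lmodType R) (S C : set E) : Prop :=
  [/\ C `<=` S,
      convex_set C &
      forall (x y : E) (l : R), S x -> S y -> 0 < l < 1 ->
        C (l *: x + (1 - l) *: y) -> C x /\ C y].

Definition segment (R : realType) (E : lmodType R) (x y : E) : set E :=
  [set z | exists l : R, 0 <= l <= 1 /\ z = l *: x + (1 - l) *: y].

(* [p i j k] stands for p_{ij,k}. *)
Definition stochastic_tensor (R : realType) (p : nat -> nat -> nat -> R) : Prop :=
  [/\ (forall i j k, 0 <= p i j k),
      (forall i j k, p i j k = p j i k) &
      (forall i j, series (p i j) @ \oo --> (1 : R))].

(* [\esum] is the unordered sum of a nonnegative family. For x and y in the
   simplex and p a stochastic tensor, the family is nonnegative with sum at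
   most 1, so that [fine] loses nothing. *)
Definition tildeV (R : realType) (p : nat -> nat -> nat -> R)
    (x y : nat -> R) : nat -> R :=
  fun k => fine (\esum_(ij in [set: nat * nat])
                   (p ij.1 ij.2 k * x ij.1 * y ij.2)%:E).

Definition quadratic_operator (R : realType) (p : nat -> nat -> nat -> R)
    (V : {fun simplex R >-> simplex R}) : Prop :=
  stochastic_tensor p /\ forall x, simplex R x -> V x = tildeV p x x.

Definition volterra (R : realType) (V : {fun simplex R >-> simplex R}) : Prop :=
  exists p : nat -> nat -> nat -> R,
    quadratic_operator p V /\
    forall phi psi, extreme_points (simplex R) phi ->
      extreme_points (simplex R) psi ->
      segment phi psi (tildeV p phi psi).

Definition Fix (R : realType) (V : {fun simplex R >-> simplex R}) :
    set (nat -> R) :=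
  [set x | simplex R x /\ V x = x].

(* Main.v *)
Require Import Defs.
From mathcomp Require Import all_boot all_order all_algebra.
From mathcomp Require Import all_classical all_reals all_analysis.
From mathcomp Require Import lra.

Set Implicit Arguments.
Unset Strict Implicit.

(** Testing the Volterra condition on pairs of extreme points [e^(i), e^(j)]
    gives [p_{ij,k} = 0] unless [k = i] or [k = j], hence [V(x)_k <= 2 x_k].
    So [2 x - V(x)] lies in the simplex and [x] is the midpoint of [V(x)] and
    [2 x - V(x)]: any face containing [x] contains [V(x)]. For an extreme point
    [phi], the segment [[phi, phi]] in which [V(phi)] lies is [{phi}]. *)

Import Order.TTheory GRing.Theory Num.Theory.
Import numFieldNormedType.Exports.

Local Open Scope classical_set_scope.
Local Open Scope ring_scope.

(** Read from right to left: a single value becomes a sum over the whole index type, ready for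
    term-by-term comparison with another sum. *)
Lemma esum_delta (R : realType) (T : choiceType) (t : T) (a : T -> R) :
  0 <= a t -> \esum_(i in [set: T]) ((i == t)%:R * a i)%:E = (a t)%:E.
Proof.
move=> at0; rewrite -[RHS](@esum_set1 _ _ t (EFin \o a) at0) [RHS]esum_mkcond.
apply: eq_esum => i _ /=; have [->|it] := eqVneq i t; first by rewrite mul1r mem_set.
by rewrite mul0r memNset// => /eqP; exact/negP.
Qed.
Arguments esum_delta {R T} t a.

(** Tonelli for nonnegative families; it allows a double sum to be evaluated one index at a time. *)
Lemma esum_esumT (R : realType) (T1 T2 : choiceType) (a : T1 -> T2 -> \bar R) :
  (forall i j, (0 <= a i j)%E) ->
  \esum_(i in [set: T1]) \esum_(j in [set: T2]) a i j =
  \esum_(ij in [set: T1 * T2]) a ij.1 ij.2.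
Proof.
by move=> a0; rewrite esum_esum//; congr esum; apply/seteqP; split.
Qed.

Lemma esum_nonneg_series (R : realType) (x : nat -> R) (l : R) :
  (forall n, 0 <= x n) -> series x @ \oo --> l ->
  \esum_(n in [set: nat]) (x n)%:E = l%:E.
Proof.
move=> x0 xl; rewrite -nneseries_esumT; last by move=> n; rewrite lee_fin.
apply/cvg_lim => //.
rewrite (_ : (fun _ => _) = EFin \o series x); first by apply: cvg_EFin => //; exact: nearW.
by apply/funext => n /=; rewrite sumEFin.
Qed.

(** Absolute values disappear on nonnegative sequences, so the sum in [summable] is the limit 1 of
    the series, hence finite. *)
Lemma simplexE (R : realType) (x : nat -> R) :
  simplex R x <-> (forall n, 0 <= x n) /\ series x @ \oo --> (1 : R).
Proof.
split=> [[]//|[x0 x1]]; split => //; rewrite /summable.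
rewrite (eq_esum (b := EFin \o x)); last first.
  by move=> i _ /=; rewrite ger0_norm.
by rewrite (esum_nonneg_series x0 x1) ltry.
Qed.

Lemma esum_simplexZ (R : realType) (x : nat -> R) (c : R) :
  simplex R x -> 0 <= c -> \esum_(n in [set: nat]) (c * x n)%:E = c%:E.
Proof.
move=> /simplexE[x0 x1] c0; apply: esum_nonneg_series.
  by move=> n; rewrite mulr_ge0.
rewrite (_ : series _ = c *: series x); last first.
  by apply/funext => n; rewrite /series/= -mulr_sumr.
rewrite -[X in _ --> X]mulr1; exact: cvgMr.
Qed.

Lemma simplex_unit_seq (R : realType) (n : nat) : simplex R (unit_seq R n).
Proof.
apply/simplexE; split; first by move=> m; rewrite ler0n.
(* [series] at [m] sums the indices below [m], so the partial sums are constant from [n.+1] on, not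
   from [n]. *)
apply: cvg_near_cst; exists n.+1 => // m /= nm.
rewrite /series/= (bigD1_seq n) ?iota_uniq ?mem_index_iota//=.
rewrite /unit_seq eqxx big1 ?addr0// => i /negPf -> //.
Qed.

Lemma simplex_eq_unit_seq (R : realType) (x : nat -> R) (n : nat) :
  simplex R x -> (forall m, m != n -> x m = 0) -> x = unit_seq R n.
Proof.
move=> Sx xE; have [x0 _] := (simplexE x).1 Sx.
(* Written as a delta sum, [x n] agrees term by term with the total mass of [x]. *)
have xn1 : x n = 1.
  apply: EFin_inj; rewrite -(esum_delta _ x)// -(esum_simplexZ Sx)//.
  apply: eq_esum => m _; case: eqP => [->|/eqP/xE ->]; first by rewrite !mul1r.
  by rewrite !mulr0.
apply/funext => m; rewrite /unit_seq.
by case: eqP => [->//|/eqP/xE].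
Qed.

(** Away from [n], a combination of two nonnegative coordinates with positive weights is zero, so
    both coordinates vanish and all the mass of [x] and of [y] sits at [n]. *)
Lemma extreme_unit_seq (R : realType) (n : nat) :
  extreme_points (simplex R) (unit_seq R n).
Proof.
split; first exact: simplex_unit_seq.
move=> x y l Sx Sy /andP[l0 l1] xyE.
have [x0 _] := (simplexE x).1 Sx; have [y0 _] := (simplexE y).1 Sy.
have xy0 m : m != n -> x m = 0 /\ y m = 0.
  move=> /negPf mn; have := congr1 (@^~ m) xyE.
  have lx0 : 0 <= l * x m by rewrite mulr_ge0// ltW.
  have ly0 : 0 <= (1 - l) * y m by rewrite mulr_ge0// subr_ge0 ltW.
  rewrite /unit_seq mn => /eqP; rewrite (paddr_eq0 lx0 ly0) !mulf_eq0 subr_eq0.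
  rewrite (gt_eqF l0) (gt_eqF l1) /=.
  by move=> /andP[/eqP -> /eqP ->].
by split; apply: simplex_eq_unit_seq => // m /xy0[].
Qed.

Lemma segment_refl (R : realType) (E : lmodType R) (x z : E) :
  segment x x z -> z = x.
Proof. by move=> [l [_ ->]]; rewrite -scalerDl addrC subrK scale1r. Qed.

Section volterra_tensor.
Variables (R : realType) (p : nat -> nat -> nat -> R).
Hypothesis p0 : forall i j k, 0 <= p i j k.
Hypothesis p1 : forall i j, series (p i j) @ \oo --> (1 : R).

(** Turns the Volterra condition, stated on extreme points, into a condition on the entries of
    [p]. *)
Lemma tildeV_unit_seq (i j k : nat) :
  tildeV p (unit_seq R i) (unit_seq R j) k = p i j k.
Proof.
rewrite /tildeV -[RHS]/(fine (p (i, j).1 (i, j).2 k)%:E).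
rewrite -(esum_delta (i, j) (fun ij => p ij.1 ij.2 k))//.
congr fine; apply: eq_esum => -[a b] _ /=.
by rewrite -mulrA mulrC /unit_seq xpair_eqE -mulnb natrM.
Qed.

Hypothesis pV : forall phi psi, extreme_points (simplex R) phi ->
  extreme_points (simplex R) psi -> segment phi psi (tildeV p phi psi).

Lemma volterra_tensor_eq0 (i j k : nat) : k != i -> k != j -> p i j k = 0.
Proof.
move=> /negPf ki /negPf kj.
have [l [_ /(congr1 (@^~ k))]] :=
  pV (extreme_unit_seq R i) (extreme_unit_seq R j).
by rewrite tildeV_unit_seq => ->; rewrite /= /unit_seq !fctE ki kj !scaler0 addr0.
Qed.

Lemma stochastic_tensor_le1 (i j k : nat) : p i j k <= 1.
Proof.
rewrite -lee_fin -(esum_nonneg_series (p0 i j) (p1 i j)).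
rewrite -(esum_delta k (p i j))//; apply: le_esum => m _.
by rewrite lee_fin; case: eqP => _; rewrite ?mul1r ?mul0r.
Qed.

(** For fixed [k], the matrix of terms [p i j k * x i * x j] lives on row [k] and column [k], where
    each term is at most [x i * x j]. Since [x] has mass 1, the row and the column of these bounds
    each sum to [x k], whence the factor 2. *)
Lemma tildeV_le (x : nat -> R) (k : nat) :
  simplex R x -> tildeV p x x k <= 2 * x k.
Proof.
move=> Sx; have [x0 _] := (simplexE x).1 Sx.
(* [a] is row [k] and [b] is column [k] of the matrix [x i * x j], extended by zero. The entry at
   [(k, k)] is counted in both, which is harmless for an upper bound. *)
pose a i j := (i == k)%:R * x k * x j.
pose b i j := x k * x i * (j == k)%:R.
have a0 i j : 0 <= a i j by rewrite !mulr_ge0.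
have b0 i j : 0 <= b i j by rewrite !mulr_ge0.
have suma : \esum_(ij in [set: nat * nat]) (a ij.1 ij.2)%:E = (x k)%:E.
  rewrite -(esum_esumT (a := fun i j => (a i j)%:E))//.
  rewrite -(esum_delta k (fun=> x k))//; apply: eq_esum => i _.
  by rewrite esum_simplexZ// mulr_ge0.
have sumb : \esum_(ij in [set: nat * nat]) (b ij.1 ij.2)%:E = (x k)%:E.
  rewrite -(esum_esumT (a := fun i j => (b i j)%:E))//.
  rewrite -(esum_simplexZ Sx)//; apply: eq_esum => i _.
  rewrite -(esum_delta k (fun=> x k * x i)) ?mulr_ge0//.
  by apply: eq_esum => j _; rewrite mulrC.
have le2 : (\esum_(ij in [set: nat * nat])
    (p ij.1 ij.2 k * x ij.1 * x ij.2)%:E <= (2 * x k)%:E)%E.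
  rewrite mulrDl mul1r EFinD -[X in (X + _)%E]suma -[X in (_ + X)%E]sumb.
  rewrite -esumD; do ?by move=> *; rewrite lee_fin.
  apply: le_esum => -[i j] _ /=; rewrite -EFinD lee_fin.
  have xx0 : 0 <= x i * x j by rewrite mulr_ge0.
  have pxx : p i j k * x i * x j <= x i * x j.
    by rewrite -mulrA ler_piMl// stochastic_tensor_le1.
  have := a0 i j; have := b0 i j; rewrite /a /b.
  have [ik|ki] := eqVneq i k; first by subst i; rewrite mul1r; lra.
  have [jk|kj] := eqVneq j k; first by subst j; rewrite mulr1; lra.
  by rewrite volterra_tensor_eq0 1?eq_sym// !mul0r mulr0 addr0.
(* [fine] sends infinite values to 0, so it is monotone only between finite values; [le2] also
   supplies the finiteness of the sum. *)
rewrite /tildeV -[leRHS]/(fine (2 * x k)%:E); apply: fine_le => //.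
rewrite ge0_fin_numE; first exact: le_lt_trans le2 (ltry _).
by apply: esum_ge0 => ij _; rewrite lee_fin !mulr_ge0.
Qed.

End volterra_tensor.

Unset Implicit Arguments.

Theorem corollary3p5 (R : realType) (V : {fun simplex R >-> simplex R})
    (hV : volterra V) :
  (forall F : set (nat -> R), is_face (simplex R) F -> V @` F `<=` F) /\
  (extreme_points (simplex R) `<=` Fix V /\
   forall n : nat, V (unit_seq R n) = unit_seq R n).
Proof.
have [p [[[p0 _ p1] VE] pV]] := hV.
have fixV phi : extreme_points (simplex R) phi -> V phi = phi.
  by move=> ephi; rewrite VE; [exact/segment_refl/pV|case: ephi].
split; last first.
  split=> [phi ephi|n]; last exact/fixV/extreme_unit_seq.
  by split; [case: ephi|exact: fixV].
move=> F [FS _ Fface] _ [x Fx <-].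
have Sx := FS x Fx.
have SVx : simplex R (V x) by exact: funS.
have [x0 x1] := (simplexE x).1 Sx; have [Vx0 Vx1] := (simplexE (V x)).1 SVx.
pose y : nat -> R := 2 *: x - V x.
(* Nonnegativity of [y] is the bound [tildeV_le]; its mass is [2 * 1 - 1], because [V x] also has
   mass 1. *)
have Sy : simplex R y.
  apply/simplexE; split.
    by move=> k; rewrite subr_ge0 VE//; exact: (tildeV_le p0 p1 pV).
  have -> : series y = 2 *: series x - series (V x).
    by apply/funext => n; rewrite !fctE /series/= scaler_sumr -sumrB.
  rewrite [X in _ --> X](_ : 1 = 2 *: 1 - 1 :> R); last first.
    by rewrite /GRing.scale/=; lra.
  by apply: cvgB => //; exact: cvgZr.
have half : 0 < (2^-1 : R) < 1 by rewrite invr_gt0 ltr0n invf_lt1 ?ltr1n.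
apply: (Fface (V x) y 2^-1 SVx Sy half _).1.
rewrite (_ : _ + _ = x)//; apply/funext => k.
rewrite /y !fctE /GRing.scale/=; lra.
Qed.
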